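(* Let $(E,\mathcal{C},r_{\mathcal{C}})$ be a ranked central set with rank $r(\mathcal{C})$, and write its generalized Tutte polynomial as $T_{\mathcal{C}}(x,y)=\sum_{i\ge 0,\,j\ge 0}t_{ij}x^iy^j$. For $0\le n\le |E|$ let $f_n:=\#\{X\in\mathcal{C}:|X|=n\}$. Then, for all integers $k\ge 0$, \[ \sum_{i=0}^{k}\sum_{j=0}^{k-i}\binom{k-i}{j}(-1)^jt_{ij}=\sum_{n=0}^{|E|}(-1)^{r(\mathcal{C})+n}f_n\binom{k+n-r(\mathcal{C})}{k}. \]
   Context: Simplicial complex: a nonempty collection $\mathcal{C}$ of subsets of a finite set $E$ such that every subset of a member of $\mathcal{C}$ is also in $\mathcal{C}$. Ranked central set: a triple $(E,\mathcal{C},r_{\mathcal{C}})$ consisting of a finite set $E$, a nonempty simplicial complex $\mathcal{C}$ on $E$, and a function $r_{\mathcal{C}}:\mathcal{C}\to\mathbb{Z}_{\ge 0}$ such that (R0) $r_{\mathcal{C}}(\emptyset)=0$ and (R1) $r_{\mathcal{C}}(A)\le |A|$ for any $A\in\mathcal{C}$. Its rank is $r(\mathcal{C}):=\max\{r_{\mathcal{C}}(A):A\in\mathcal{C}\}$. Generalized Tutte polynomial: $T_{\mathcal{C}}(x,y):=\sum_{A\in\mathcal{C}}(x-1)^{r(\mathcal{C})-r_{\mathcal{C}}(A)}(y-1)^{|A|-r_{\mathcal{C}}(A)}$, a two-variable polynomial with integer coefficients. Binomial convention: for integers $a,b$, $\binom{a}{b}=\frac{a(a-1)\cdots(a-b+1)}{b!}$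 if $b\ge 0$ (also for negative $a$), and $\binom{a}{b}=0$ if $b<0$. *)

(* Defs.v *)
From HB Require Import structures.
From mathcomp Require Import all_boot all_order all_algebra.

Set Implicit Arguments.
Unset Strict Implicit.
Unset Printing Implicit Defensive.

Import Order.TTheory GRing.Theory Num.Theory.
Local Open Scope ring_scope.

Definition simplicial_complex (E : finType) (C : {set {set E}}) : Prop :=
  C != set0 /\ forall A B : {set E}, A \in C -> B \subset A -> B \in C.

(* The rank function is only meaningful on the faces: [rk] is a total function
   for convenience, and its values off [faces] are unconstrained and unused. *)
Record ranked_central_set (E : finType) := RankedCentralSet {
  faces : {set {set E}};
  rk : {set E} -> nat;
  faces_complex : simplicial_complex faces;
  rk_set0 : rk set0 = 0%N;
  rk_le_card : forall A : {set E}, A \in faces -> (rk A <= #|A|)%N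
}.

Section RankedCentralSet.
Variables (E : finType) (C : ranked_central_set E).

Definition rank : nat := \max_(A in faces C) rk C A.

(* x is the outer variable 'X and y is the inner variable 'Y = 'X%:P.
   Both truncated subtractions are exact, since rk C A is at most rank and
   at most #|A| for every face A. *)
Definition tutte : {poly {poly int}} :=
  \sum_(A in faces C)
    ('X - 1) ^+ (rank - rk C A) * ('Y - 1) ^+ (#|A| - rk C A).

(* the coefficient of x^i y^j *)
Definition tutte_coef (i j : nat) : int := tutte`_i`_j.

Definition face_number (n : nat) : nat := #|[set X in faces C | #|X| == n]|.

End RankedCentralSet.

(* Generalized binomial coefficient for integers a and b, possibly negative.
   The integer division is exact, see [binz_rat]. *)
Definition binz (a b : int) : int :=
  match b with
  | Posz n => (\prod_(i < n) (a - i%:Z) %/ (n`!)%:Z)%Z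
  | Negz _ => 0
  end.

Lemma dvdz_fact_prod (a : int) (n : nat) :
  ((n`!)%:Z %| \prod_(i < n) (a - i%:Z))%Z.
Proof.
case: a => m.
  have -> : \prod_(i < n) (m%:Z - i%:Z) = (m ^_ n)%:Z.
    elim: n => [|n IHn]; first by rewrite big_ord0.
    rewrite big_ord_recr /= IHn ffactnSr PoszM.
    have [le_nm | lt_mn] := leqP n m; first by rewrite subzn.
    by rewrite ffact_small // !mul0r.
  by rewrite -bin_ffact PoszM dvdz_mull.
have -> : \prod_(i < n) (Negz m - i%:Z) = (-1) ^+ n * ((m + n) ^_ n)%:Z.
  elim: n => [|n IHn]; first by rewrite big_ord0.
  rewrite big_ord_recr /= IHn addnS ffactSS PoszM exprS NegzE -opprD.
  rewrite -PoszD addSn mulrN mulN1r mulNr; congr (- _).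
  by rewrite -!mulrA; congr (_ * _); rewrite mulrC.
by rewrite -bin_ffact PoszM dvdz_mull // dvdz_mull.
Qed.

Lemma binz_rat (a : int) (n : nat) :
  (binz a n)%:~R = (\prod_(i < n) (a - i%:Z))%:~R / (n`!)%:R :> rat.
Proof.
have n_neq0 : (n`!)%:R != 0 :> rat by rewrite pnatr_eq0 -lt0n fact_gt0.
apply: (mulIf n_neq0); rewrite divfK // -[(n`!)%:R]/((n`!)%:Z%:~R) -intrM.
by rewrite /binz divzK // dvdz_fact_prod.
Qed.

(* Main.v *)
Require Import Defs.
From mathcomp Require Import all_boot all_order all_algebra.
From mathcomp Require Import ring zify.
Import GRing.Theory Num.Theory.
Local Open Scope ring_scope.

(** For fixed [k] the left-hand side is the value at the Tutte polynomial of an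
    additive functional L_k on bivariate polynomials ([brylawski_sum]), so it
    suffices to evaluate L_k at the term (x-1)^a (y-1)^b that a face [A]
    contributes, where a = r(C) - r(A) and b = |A| - r(A).  The value is
    (-1)^(a+b) binom(k+b-a, k) ([brylawski_sum_term]), which depends on [A] only
    through b - a = |A| - r(C); grouping the faces by size gives the
    right-hand side.

    The evaluation is an induction on [a].  Multiplication by x lowers [k],
    that is, L_(k+1)(x p) = L_k(p) and L_0(x p) = 0, so that
    L_(k+1)((x-1) p) = L_k(p) - L_(k+1)(p), and the claimed value obeys the same
    recursion by Pascal's rule for generalized binomials ([binz_pascal]).  For
    a = 0 only the powers of y remain, and the sum over j of
    binom(k,j) binom(b,j) is Vandermonde's convolution. *)

(** * Generalized binomial coefficients *)

Lemma binz_fact (a : int) (n : nat) :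
  binz a n * (n`!)%:Z = \prod_(i < n) (a - i%:Z).
Proof. by rewrite /binz divzK // dvdz_fact_prod. Qed.

Lemma binz0 (a : int) : binz a 0%:Z = 1.
Proof. by rewrite -[LHS]mulr1 (binz_fact a 0) big_ord0. Qed.

(** Over the common denominator (n+1)!, the product x(x-1)...(x-n+1) factors
    out of all three terms and leaves x + 1 = (n + 1) + (x - n). *)
Lemma binz_pascal (x : int) (n : nat) :
  binz (x + 1) n.+1%:Z = binz x n%:Z + binz x n.+1%:Z.
Proof.
have fact_neq0 : ((n.+1)`!)%:Z != 0 :> int by rewrite eqz_nat -lt0n fact_gt0.
apply: (mulIf fact_neq0); rewrite mulrDl !binz_fact.
rewrite big_ord_recl big_ord_recr /= subr0 factS mulnC PoszM mulrA binz_fact.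
rewrite (eq_bigr (fun i : 'I_n => x - i%:Z)) => [|i _];
  last by rewrite /bump; lia.
by rewrite -[n.+1]add1n PoszD; ring.
Qed.

Lemma binz_nat (m n : nat) : binz m%:Z n%:Z = 'C(m, n)%:Z.
Proof.
elim: m n => [|m IHm] [|n]; rewrite ?binz0 ?bin0 //.
  have fact_neq0 : ((n.+1)`!)%:Z != 0 :> int by rewrite eqz_nat -lt0n fact_gt0.
  by apply: (mulIf fact_neq0); rewrite binz_fact big_ord_recl subr0 !mul0r.
by rewrite -[m.+1]addn1 PoszD binz_pascal !IHm addn1 binS PoszD addrC.
Qed.

(** * The functional on bivariate polynomials *)

Definition brylawski_sum (k : nat) (p : {poly {poly int}}) : int :=
  \sum_(i < k.+1) \sum_(j < (k - i).+1)
     'C(k - i, j)%:Z * (-1) ^+ j * p`_i`_j.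

Lemma brylawski_sumB k : {morph brylawski_sum k : p q / p - q}.
Proof.
move=> p q; rewrite /brylawski_sum -sumrB; apply: eq_bigr => i _.
by rewrite -sumrB; apply: eq_bigr => j _; rewrite !coefB mulrBr.
Qed.

Lemma brylawski_sum_sum k (I : finType) (P : pred I) F :
  brylawski_sum k (\sum_(A | P A) F A) = \sum_(A | P A) brylawski_sum k (F A).
Proof.
rewrite /brylawski_sum exchange_big; apply: eq_bigr => i _ /=.
rewrite exchange_big; apply: eq_bigr => j _ /=.
by rewrite !coef_sum mulr_sumr.
Qed.

Lemma brylawski_sum0X p : brylawski_sum 0 ('X * p) = 0.
Proof. by rewrite /brylawski_sum !big_ord1 coefXM coef0 mulr0. Qed.

(** The weights depend on [k] and on the x-exponent [i] only through [k - i],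
    and [i = 0] contributes nothing since x p has no constant term. *)
Lemma brylawski_sumSX k p : brylawski_sum k.+1 ('X * p) = brylawski_sum k p.
Proof.
rewrite /brylawski_sum big_ord_recl big1 ?add0r => [|j _]; last first.
  by rewrite coefXM coef0 mulr0.
by apply: eq_bigr => i _; apply: eq_bigr => j _; rewrite coefXM.
Qed.

Lemma coef_Xsub1_exp (b j : nat) :
  (('X - 1 : {poly int}) ^+ b)`_j = (-1) ^+ (b - j) * 'C(b, j)%:Z.
Proof.
rewrite addrC exprDn coef_sum.
under eq_bigr => i _.
  rewrite -polyC1 -polyCN -polyC_exp coefMn coefCM coefXn; over.
have [le_jb | lt_bj] := leqP j b.
  rewrite (bigD1 (Ordinal (le_jb : j < b.+1)%N)) //= eqxx mulr1 big1 ?addr0.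
    by rewrite -mulr_natr natz.
  move=> i; rewrite -val_eqE /= eq_sym => /negPf ->.
  by rewrite mulr0 mul0rn.
rewrite bin_small // mulr0 big1 // => i _.
by rewrite gtn_eqF ?mulr0 ?mul0rn // (leq_ltn_trans _ lt_bj) // -ltnS.
Qed.

(** The signs (-1)^j of the functional and (-1)^(b-j) of the expansion combine
    to the constant (-1)^b, leaving Vandermonde's convolution of
    binom(b,j) with binom(k,k-j). *)
Lemma brylawski_sum_Y k b :
  brylawski_sum k (('Y - 1) ^+ b) = (-1) ^+ b * 'C(k + b, k)%:Z.
Proof.
rewrite -polyC1 -polyCB -polyC_exp /brylawski_sum big_ord_recl /= subn0.
rewrite [X in _ + X]big1 ?addr0 => [|i _]; last first.
  by rewrite big1 // => j _; rewrite coefC /= coef0 mulr0.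
rewrite addnC -binomial.Vandermonde -natz natr_sum mulr_sumr.
apply: eq_bigr => j _; rewrite coefC /= coef_Xsub1_exp.
have le_jk : (j <= k)%N by rewrite -ltnS.
rewrite bin_sub // natz PoszM; have [le_jb | lt_bj] := leqP j b; last first.
  by rewrite ['C(b, j)]bin_small // !(mulr0, mul0r).
have -> : (-1) ^+ b = (-1) ^+ (b - j) * (-1) ^+ j :> int.
  by rewrite -exprD subnK.
by ring.
Qed.

Lemma brylawski_sum_term k a b :
  brylawski_sum k (('X - 1) ^+ a * ('Y - 1) ^+ b)
  = (-1) ^+ (a + b) * binz (k%:Z + b%:Z - a%:Z) k%:Z.
Proof.
elim: a k => [|a IHa] k.
  by rewrite expr0 mul1r brylawski_sum_Y subr0 -PoszD binz_nat.
rewrite exprS -mulrA mulrBl mul1r brylawski_sumB IHa.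
case: k => [|k]; first by rewrite brylawski_sum0X !binz0 addSn exprS; ring.
rewrite brylawski_sumSX IHa addSn exprS.
rewrite (_ : k.+1%:Z + b%:Z - a%:Z = (k%:Z + b%:Z - a%:Z) + 1); last by lia.
rewrite binz_pascal.
rewrite (_ : k.+1%:Z + b%:Z - a.+1%:Z = k%:Z + b%:Z - a%:Z); last by lia.
by ring.
Qed.

(** * Summation over the faces *)

Lemma sum_face_number (E : finType) (C : ranked_central_set E) (g : nat -> int) :
  \sum_(n < #|E|.+1) (face_number C n)%:Z * g n = \sum_(A in faces C) g #|A|.
Proof.
rewrite (partition_big (fun A : {set E} => inord #|A| : 'I_(#|E|.+1)) xpredT) //=.
apply: eq_bigr => n _.
have inordE (A : {set E}) : (inord #|A| == n) = (#|A| == n).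
  by rewrite -val_eqE /= inordK // ltnS max_card.
under [RHS]eq_bigl => A do rewrite inordE.
under [RHS]eq_bigr => A /andP[_ /eqP ->] do [].
rewrite sumr_const /face_number -mulr_natl natz; congr (Posz _ * _).
by apply: eq_card => A; rewrite !inE.
Qed.

Theorem theorem1p2 (E : finType) (C : ranked_central_set E) (k : nat) :
  \sum_(i < k.+1) \sum_(j < (k - i).+1)
     binz (k%:Z - i%:Z) j%:Z * (-1) ^+ j * tutte_coef C i j
  = \sum_(n < #|E|.+1)
     (-1) ^+ (rank C + n) * (face_number C n)%:Z
       * binz (k%:Z + n%:Z - (rank C)%:Z) k%:Z.
Proof.
transitivity (brylawski_sum k (tutte C)).
  apply: eq_bigr => i _; apply: eq_bigr => j _.
  have le_ik : (i <= k)%N by rewrite -ltnS.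
  by rewrite (subzn le_ik) binz_nat.
under [RHS]eq_bigr => n _ do rewrite [_ * (face_number C n)%:Z]mulrC -mulrA.
rewrite (sum_face_number _ C (fun n => (-1) ^+ (rank C + n)
                           * binz (k%:Z + n%:Z - (rank C)%:Z) k%:Z)).
rewrite brylawski_sum_sum; apply: eq_bigr => A CA.
have le_rk : (rk C A <= rank C)%N by exact: (leq_bigmax_cond _ CA).
have le_card := rk_le_card CA.
rewrite brylawski_sum_term; congr (_ * binz _ _); last by lia.
(* The two exponents differ by 2 r(A). *)
rewrite -signr_odd -[RHS]signr_odd; congr (_ ^+ nat_of_bool _).
by rewrite !oddD !oddB //; do 3!case: odd.
Qed.
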